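(* Let $W$ be a web world on $n$ pegs and let $A=(a_{ij})$ be the $n\times n$ matrix with $a_{ij}$ equal to the number of edges joining pegs $i$ and $j$ (in any diagram of $W$) if $i<j$, and $a_{ij}=0$ if $i\ge j$. For each $i$ let $s_i$ be the sum of the entries of row $i$ plus the sum of the entries of column $i$ of $A$. Then the number of distinct web diagrams in $W$ is $$|W|=\frac{\prod_{i=1}^n s_i!}{\prod_{1\le i<j\le n}a_{ij}!}.$$
   Context: A web diagram on $n$ pegs is a set of distinct 4-tuples $(x_j,y_j,a_j,b_j)$ of positive integers with $1\le x_j<y_j\le n$ (edge from peg $x_j$ at height $a_j$ to peg $y_j$ at height $b_j$) such that on each peg $i$ the heights of the endpoints are exactly $1,\dots,p_i$, where $p_i$ is the number of edge endpoints on peg $i$. The web world $W(D)$ of $D$ is the set of all web diagrams obtained from $D$ by permuting the heights $1,\dots,p_i$ independently on each peg $i$; all its diagrams have the same numbers of edges between each pair of pegs. *)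

(* Defs.v *)
From HB Require Import structures.
From mathcomp Require Import all_boot all_order all_algebra all_fingroup.
From mathcomp Require Import finmap.

Set Implicit Arguments.
Unset Strict Implicit.
Unset Printing Implicit Defensive.

Local Open Scope fset_scope.

(* Pegs 1, ..., n are encoded 0-based by 'I_n; heights stay 1-based.          *)
Definition edge (n : nat) : Type := ('I_n * 'I_n * nat * nat)%type.
HB.instance Definition _ (n : nat) := Choice.on (edge n).

Section WebDiagrams.
Variable n : nat.
Implicit Types (e : edge n) (D : {fset edge n}) (i j : 'I_n).

Definition lpeg e : 'I_n := e.1.1.1.
Definition rpeg e : 'I_n := e.1.1.2.
Definition lheight e : nat := e.1.2.
Definition rheight e : nat := e.2.

(* With multiplicity: one entry per edge endpoint on peg i.                   *)
Definition endpoint_heights D i : seq nat :=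
  [seq lheight e | e <- enum_fset D & lpeg e == i] ++
  [seq rheight e | e <- enum_fset D & rpeg e == i].

Definition nb_endpoints D i : nat := size (endpoint_heights D i).

Definition web_diagram D : Prop :=
  (forall e, e \in D -> [&& lpeg e < rpeg e, 0 < lheight e & 0 < rheight e]) /\
  (forall i, perm_eq (endpoint_heights D i) (iota 1 (nb_endpoints D i))).

(* 'S_p acts on {0, ..., p-1}; it is shifted to act on heights {1, ..., p}.   *)
Definition perm_height p (s : 'S_p) (h : nat) : nat :=
  if insub h.-1 is Some k then (s k : nat).+1 else h.

Definition permute_edge (p : 'I_n -> nat) (s : forall i, 'S_(p i)) e : edge n :=
  (lpeg e, rpeg e,
   perm_height (s (lpeg e)) (lheight e), perm_height (s (rpeg e)) (rheight e)).

Definition permute_heights D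
    (s : {dffun forall i : 'I_n, 'S_(nb_endpoints D i)}) : {fset edge n} :=
  [fset permute_edge s e | e in D].

Definition web_world_of D : {fset {fset edge n}} :=
  [fset permute_heights s
  | s in {: {dffun forall i : 'I_n, 'S_(nb_endpoints D i)}}].

Definition web_world (W : {fset {fset edge n}}) : Prop :=
  exists2 D, web_diagram D & W = web_world_of D.

Definition edge_matrix D : 'M[nat]_n :=
  \matrix_(i, j)
    if i < j then #|` [fset e in D | (lpeg e == i) && (rpeg e == j)]| else 0.

Definition row_col_sum (A : 'M[nat]_n) i : nat :=
  \sum_j A i j + \sum_j A j i.

End WebDiagrams.

(* Main.v *)
Require Import Defs.
From mathcomp Require Import all_boot all_order all_algebra all_fingroup.
From mathcomp Require Import finmap.

Set Implicit Arguments.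
Unset Strict Implicit.
Unset Printing Implicit Defensive.

Local Open Scope fset_scope.

(** Every family of height permutations yields a diagram of the world, so it
    suffices to show that all fibers of this surjection have prod a_ij!
    elements.  Each point (peg, height) is the endpoint of exactly one edge, so
    two families with the same image differ by a permutation of the edges
    preserving both pegs, and conversely each such permutation of the edges is
    induced by a unique family of height permutations. *)

(** * Counting: fibers of constant size, and permutations compatible with a map *)

Lemma card_fibers (G : finType) (K : choiceType) (f : G -> K) (m : nat) :
    (forall y, #|[set x | f x == f y]| = m) ->
  #|G| = #|` [fset f x | x in {: G}]| * m.
Proof.
move=> fib; set W := [fset f x | x in {: G}].
have fW x : f x \in W by apply: in_imfset.
rewrite -sum1_card (partition_big (fun x => [` fW x]) predT) //=.
rewrite cardfE -sum_nat_const; apply: eq_bigr => -[z zW] _.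
have /imfsetP[y _ zE] := zW.
rewrite -(fib y) -sum1_card; apply: eq_bigl => x.
by rewrite inE -val_eqE /= zE.
Qed.

Lemma card_fset_filter (K : choiceType) (E : {fset K}) (P : pred K) :
  #|` [fset e in E | P e]| = count P (enum_fset E).
Proof. by rewrite (@card_in_imfset _ _ _ id) //= -size_filter. Qed.

(** Such a permutation amounts to a family of independent permutations of the fibers of [f]. The map
    [p] glues a family [g], with [g j] supported on the fiber over [j], by letting [g (f x)] act on
    [x]. *)
Lemma card_perm_preserving (T J : finType) (f : T -> J) :
  #|[set s : {perm T} | [forall x, f (s x) == f x]]| =
  \prod_j #|[set x | f x == j]| `!.
Proof.
pose S j := Sym [set x | f x == j].
have fS (g : {ffun J -> {perm T}}) j x :
    g \in family (fun j => mem (S j)) -> (f (g j x) == j) = (f x == j).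
  by move=> /familyP/(_ j); rewrite inE => /(perm_closed x); rewrite !inE.
pose F (g : {ffun J -> {perm T}}) x := g (f x) x.
have fF g x : g \in family (fun j => mem (S j)) -> f (F g x) = f x.
  by move=> gS; apply/eqP; rewrite fS.
have Finj g : g \in family (fun j => mem (S j)) -> injective (F g).
  move=> gS x y Fxy; have fxy : f x = f y by rewrite -(fF g) // Fxy fF.
  by move: Fxy; rewrite /F fxy => /perm_inj.
(* The default [1] is never reached for [g] in the family, by [Finj]. *)
pose p g := if injectiveP (F g) is ReflectT i then perm i else 1%g.
have pE g x : g \in family (fun j => mem (S j)) -> p g x = F g x.
  rewrite /p => /Finj gi; case: injectiveP => [i|//]; exact: permE.
have cardS : #|family (fun j => mem (S j))| = \prod_j #|[set x | f x == j]| `!.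
  rewrite card_family foldrE big_map big_enum /=.
  by apply: eq_bigr => j _; rewrite card_Sym.
rewrite -cardS -(@card_in_imset _ _ p) => [|g h gS hS gh].
  apply/esym/eq_card => s; rewrite !inE; apply/imsetP/forallP => [[g gS ->] x|sf].
    by rewrite pE // fF.
  (* The preimage of [s] under [p]: its restriction to each fiber, extended by the identity. *)
  have ri j : injective (fun x => if f x == j then s x else x).
    move=> x y; case: eqP => fx; case: eqP => fy; [exact: perm_inj| | |by []].
      by move=> sxy; case: fy; rewrite -sxy (eqP (sf x)).
    by move=> sxy; case: fx; rewrite sxy (eqP (sf y)).
  have gS : [ffun j => perm (ri j)] \in family (fun j => mem (S j)).
    apply/familyP => j; rewrite ffunE !inE; apply/subsetP => x.
    by rewrite !inE permE; case: ifP => //; rewrite eqxx.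
  exists [ffun j => perm (ri j)] => //.
  by apply/permP => x; rewrite pE // /F ffunE permE eqxx.
(* Injectivity of [p]: [g j] can be read off [p g] on the fiber over [j], and is the identity
   elsewhere. *)
apply/ffunP => j; apply/permP => x.
case: (eqVneq (f x) j) => [<-|fxj]; first by rewrite -[LHS]/(F g x) -pE // gh pE.
have fixS (k : {ffun J -> {perm T}}) :
    k \in family (fun j => mem (S j)) -> k j x = x.
  by move=> /familyP/(_ j); rewrite inE => /out_perm; apply; rewrite inE.
by rewrite !fixS.
Qed.

Lemma perm_filter_enum (K : choiceType) (D : {fset K}) (x : {perm D}) (P : pred K) :
    (forall e, P (val (x e)) = P (val e)) ->
  perm_eq [seq val (x e) | e <- enum {: D} & P (val e)] [seq e <- enum_fset D | P e].
Proof.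
move=> xP; rewrite enum_fsetE [X in perm_eq _ X]filter_map map_comp; apply: perm_map.
apply: uniq_perm; last first.
- move=> e; rewrite mem_filter mem_enum /=; apply/mapP/andP.
    by move=> [e']; rewrite mem_filter /= => /andP[Pe' _] ->; rewrite xP.
  case=> Pe _; exists (x^-1 e)%g; last by rewrite permKV.
  by rewrite mem_filter /= -xP permKV Pe mem_enum.
- exact/filter_uniq/enum_uniq.
- by rewrite (map_inj_uniq perm_inj); apply/filter_uniq/enum_uniq.
Qed.

(** * Permutations acting on heights *)

Lemma perm_heightS p (s : 'S_p) (k : 'I_p) : perm_height s k.+1 = (s k).+1.
Proof. by rewrite /perm_height /= valK. Qed.

Lemma perm_heightM p (s t : 'S_p) h :
  perm_height (s * t) h = perm_height t (perm_height s h).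
Proof.
rewrite {1 3}/perm_height; case: insubP => [k _ _|nk].
  by rewrite perm_heightS permM.
by rewrite /perm_height insubN.
Qed.

(** The restriction to [iota 1 p] matters: because of the predecessor in [perm_height], height 0 is
    treated like height 1. *)
Lemma perm_height_inj p (s : 'S_p) : {in iota 1 p &, injective (perm_height s)}.
Proof.
move=> h k; rewrite !mem_iota !add1n !ltnS.
case: h => // h; case: k => // k /= hp kp.
rewrite -[h]/(val (Ordinal hp)) -[k]/(val (Ordinal kp)) !perm_heightS.
by move=> -[] /val_inj/perm_inj->.
Qed.

Lemma perm_height_eq p (s t : 'S_p) :
  {in iota 1 p, perm_height s =1 perm_height t} -> s = t.
Proof.
move=> st; apply/permP => k; apply/val_inj; apply: succn_inj.
by rewrite -!perm_heightS st // mem_iota add1n !ltnS ltn_ord.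
Qed.

(** Both lists enumerate the heights without repetition, so entries at equal positions can be
    matched. *)
Lemma perm_iota_perm_height p (u v : seq nat) :
  perm_eq u (iota 1 p) -> perm_eq v (iota 1 p) ->
  exists s : 'S_p, map (perm_height s) u = v.
Proof.
move=> pu pv.
have [su sv] : size u = p /\ size v = p.
  by rewrite (perm_size pu) (perm_size pv) size_iota.
have [uu uv] : uniq u /\ uniq v.
  by rewrite (perm_uniq pu) (perm_uniq pv) iota_uniq.
have iu (k : 'I_p) : index k.+1 u < p.
  by rewrite -[X in _ < X]su index_mem (perm_mem pu) mem_iota add1n !ltnS ltn_ord.
have nv (k : 'I_p) : 0 < nth 0 v (index k.+1 u) <= p.
  have: nth 0 v (index k.+1 u) \in v by rewrite mem_nth // sv.
  by rewrite (perm_mem pv) mem_iota add1n ltnS.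
(* The index [k] stands for height [k.+1]; its image is the entry of [v] at the position of that
   height in [u], shifted back to start at 0. *)
have lt_f (k : 'I_p) : (nth 0 v (index k.+1 u)).-1 < p.
  by case: (nth _ _ _) (nv k).
pose f k := Ordinal (lt_f k).
have fS k : (f k).+1 = nth 0 v (index k.+1 u).
  by rewrite /= prednK //; case/andP: (nv k).
have f_inj : injective f.
  move=> k l /(congr1 (fun i : 'I_p => i.+1)); rewrite !fS => /eqP.
  rewrite nth_uniq ?sv // => /eqP ekl.
  apply/val_inj; apply: succn_inj; apply: (index_inj 0 _ _ ekl).
    by rewrite (perm_mem pu) mem_iota add1n !ltnS ltn_ord.
  by rewrite (perm_mem pu) mem_iota add1n !ltnS ltn_ord.
exists (perm f_inj); apply: (@eq_from_nth _ 0); rewrite ?size_map ?su // => i ip.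
rewrite (nth_map 0) ?su //.
have := mem_nth 0 (eq_ind_r (fun m => i < m) ip su).
rewrite (perm_mem pu) mem_iota add1n ltnS; case Eh: (nth 0 u i) => [//|h] /= hp.
by rewrite -[h]/(val (Ordinal hp)) perm_heightS permE fS /= -Eh index_uniq ?su.
Qed.

(** * Fibers of the action on a fixed web diagram *)

Section WebWorld.
Variables (n : nat) (D : {fset edge n}).
Hypothesis webD : web_diagram D.
Implicit Types (i j : 'I_n) (s t : {dffun forall i : 'I_n, 'S_(nb_endpoints D i)}).

Lemma lheight_endpoint e : e \in D -> lheight e \in endpoint_heights D (lpeg e).
Proof. by move=> eD; rewrite mem_cat map_f // mem_filter eqxx. Qed.

Lemma rheight_endpoint e : e \in D -> rheight e \in endpoint_heights D (rpeg e).
Proof. by move=> eD; rewrite mem_cat [X in _ || X]map_f ?orbT // mem_filter eqxx. Qed.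

(** Pegs do not move, so edges with equal images are acted on by the same two permutations, each
    injective on the heights present. *)
Lemma permute_edge_inj s : {in D &, injective (permute_edge s)}.
Proof.
move=> [[[i j] a] b] [[[i' j'] a'] b'] eD eD'.
have := (lheight_endpoint eD, rheight_endpoint eD,
         lheight_endpoint eD', rheight_endpoint eD').
rewrite !(perm_mem (webD.2 _)) /permute_edge /= => -[[[Ha Hb]] Ha' Hb'] [ei ej].
move: Ha' Hb'; rewrite /lpeg /rpeg /lheight /rheight /= in ei ej Ha Hb *.
rewrite -ei -ej => Ha' Hb' /(perm_height_inj Ha Ha')-> /(perm_height_inj Hb Hb')->.
by [].
Qed.

(** Every height of every peg is an endpoint of some edge of [D], so the action on edges determines
    each permutation. *)
Lemma permute_edge_eq s t : {in D, permute_edge s =1 permute_edge t} -> s = t.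
Proof.
move=> st; apply/ffunP => i; apply: perm_height_eq => h.
rewrite -(perm_mem (webD.2 i)) mem_cat.
by case/orP=> /mapP[e]; rewrite mem_filter => /andP[/eqP<- /st[]] ? ? ->.
Qed.

Definition peg_preserving (x : {perm D}) : bool :=
  [forall e, (lpeg (val (x e)), rpeg (val (x e))) == (lpeg (val e), rpeg (val e))].

Lemma peg_preserving_permute (x : {perm D}) : peg_preserving x ->
  exists s, forall e : D, permute_edge s (val e) = val (x e).
Proof.
move=> /forallP xP.
have xl e : lpeg (val (x e)) = lpeg (val e) by case/eqP: (xP e).
have xr e : rpeg (val (x e)) = rpeg (val e) by case/eqP: (xP e).
(* The heights of the images under [x], listed in the same order as [endpoint_heights D i] lists
   those of the edges themselves. *)
pose v i := [seq lheight (val (x e)) | e <- enum {: D} & lpeg (val e) == i] ++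
            [seq rheight (val (x e)) | e <- enum {: D} & rpeg (val e) == i].
have pv i : perm_eq (v i) (iota 1 (nb_endpoints D i)).
  apply: perm_trans (webD.2 i); rewrite /v /endpoint_heights.
  rewrite (map_comp (@lheight n)) (map_comp (@rheight n)).
  apply: perm_cat; apply: perm_map.
    by apply: (perm_filter_enum (P := fun e => lpeg e == i)) => e; rewrite xl.
  by apply: (perm_filter_enum (P := fun e => rpeg e == i)) => e; rewrite xr.
have /fin_all_exists[s sP] i := perm_iota_perm_height (webD.2 i) (pv i).
exists [ffun i => s i] => e.
(* The equality of lists splits into left and right endpoints because the corresponding halves have
   equal lengths. *)
have {sP} : forall i,
   {in [seq e <- enum {: D} | lpeg (val e) == i], forall e,
       perm_height (s i) (lheight (val e)) = lheight (val (x e))} /\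
   {in [seq e <- enum {: D} | rpeg (val e) == i], forall e,
       perm_height (s i) (rheight (val e)) = rheight (val (x e))}.
  move=> i; have := sP i; rewrite /endpoint_heights enum_fsetE.
  rewrite !(filter_map (val : D -> edge n)).
  rewrite map_cat -!map_comp => /eqP; rewrite eqseq_cat ?size_map //.
  by case/andP=> /eqP/eq_in_map ? /eqP/eq_in_map ?; split.
move=> sP; rewrite /permute_edge !ffunE.
have [sl _] := sP (lpeg (val e)); have [_ sr] := sP (rpeg (val e)).
rewrite sl; last by rewrite mem_filter eqxx mem_enum.
rewrite sr; last by rewrite mem_filter eqxx mem_enum.
by rewrite -xl -xr; case: (val (x e)) => [[[]]].
Qed.

Lemma permute_edgeM s t (e : edge n) :
  permute_edge
    ([ffun i => (s i * t i)%g] : {dffun forall i, 'S_(nb_endpoints D i)}) e =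
  permute_edge t (permute_edge s e).
Proof. by rewrite /permute_edge !ffunE !perm_heightM. Qed.

Lemma card_permute_heights_fiber t :
  #|[set s | permute_heights (D := D) s == permute_heights t]| =
  #|[set x | peg_preserving x]|.
Proof.
(* [r x] first realizes [x] by height permutations, then applies [t]; the value [t] for other [x] is
   a mere default. *)
have /fin_all_exists[r rP] (x : {perm D}) :
    exists s, peg_preserving x ->
      forall e : D, permute_edge s (val e) = permute_edge t (val (x e)).
  case: (boolP (peg_preserving x)) => [/peg_preserving_permute[s sE]|_]; last by exists t.
  by exists [ffun i => (s i * t i)%g] => _ e; rewrite permute_edgeM sE.
have rinj : {in [set x | peg_preserving x] &, injective r}.
  move=> x y; rewrite !inE => /rP xE /rP yE rxy; apply/permP => e; apply/val_inj.
  by apply: (@permute_edge_inj t _ _ (valP _) (valP _)); rewrite -xE -yE rxy.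
rewrite -(card_in_imset rinj); apply: eq_card => s; rewrite inE.
apply/eqP/imsetP => [st|[x]]; last first.
  rewrite inE => /rP xE ->; apply/fsetP => d; apply/imfsetP/imfsetP => -[e /= eD ->].
    by exists (val (x [` eD])); [exact: valP | rewrite -xE].
  by exists (val ((x^-1)%g [` eD])); [exact: valP | rewrite xE permKV].
(* Conversely, for [s] in the fiber, each [s]-image of an edge is the [t]-image of some edge; this
   matching is the wanted permutation, and it keeps pegs since neither [s] nor [t] moves them. *)
have /fin_all_exists[x xE] (e : D) :
    exists d : D, permute_edge s (val e) = permute_edge t (val d).
  have : permute_edge s (val e) \in permute_heights t.
    by rewrite -st; apply/in_imfset/valP.
  by case/imfsetP=> d /= dD ->; exists [` dD].
have xinj : injective x.
  move=> d e xde; apply/val_inj; apply: (@permute_edge_inj s _ _ (valP _) (valP _)).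
  by rewrite !xE xde.
have pegx : peg_preserving (perm xinj).
  by apply/forallP => e; rewrite permE; case: (xE e) => -> ->.
exists (perm xinj); first by rewrite inE.
apply: permute_edge_eq => e eD.
by rewrite (rP _ pegx [` eD]) permE -xE.
Qed.

Lemma edge_matrix_permute_heights s : edge_matrix (permute_heights s) = edge_matrix D.
Proof.
apply/matrixP => i j; rewrite !mxE; case: ifP => // _.
pose B := [fset e in D | (lpeg e == i) && (rpeg e == j)].
have -> : [fset e in permute_heights s | (lpeg e == i) && (rpeg e == j)] =
          [fset permute_edge s e | e in B].
  apply/fsetP => d; rewrite !inE; apply/andP/imfsetP => /=.
    move=> [/imfsetP[e /= eD ->] eij]; exists e => //.
    by rewrite !inE eD.
  case=> e; rewrite !inE => /andP[eD eij] ->; split=> //.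
  exact: in_imfset.
rewrite card_in_imfset // => d e; rewrite !inE => /andP[dD _] /andP[eD _].
exact: permute_edge_inj.
Qed.

(** The zero entries also count edges, since every edge of a web diagram has its left peg below its
    right peg. *)
Lemma edge_matrixE i j :
  edge_matrix D i j = count (fun e => (lpeg e == i) && (rpeg e == j)) (enum_fset D).
Proof.
rewrite mxE card_fset_filter; case: ifP => // nij.
apply/esym/eqP; rewrite -leqn0 leqNgt -has_count; apply/hasPn => e /webD.1 /and3P[lr _ _].
by apply/negP => /andP[/eqP ei /eqP ej]; rewrite -ei -ej lr in nij.
Qed.

(** Row [i] sorts the edges starting at peg [i] by their right peg, and column [i] those ending
    there by their left peg. *)
Lemma row_col_sum_edge_matrix i : row_col_sum (edge_matrix D) i = nb_endpoints D i.
Proof.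
rewrite /nb_endpoints /endpoint_heights size_cat !size_map !size_filter.
rewrite -!sum1_count (partition_big (@rpeg n) predT) //=.
rewrite [X in (_ + X)%N](partition_big (@lpeg n) predT) //=.
congr (_ + _)%N; apply: eq_bigr => j _; rewrite edge_matrixE -sum1_count //.
by apply: eq_bigl => e; rewrite andbC.
Qed.

Lemma card_peg_preserving :
  #|[set x | peg_preserving x]| =
  \prod_(i < n) \prod_(j < n | i < j) (edge_matrix D i j)`!.
Proof.
rewrite (card_perm_preserving (fun e : D => (lpeg (val e), rpeg (val e)))).
under eq_bigr => ij _.
  have -> : #|[set e : D | (lpeg (val e), rpeg (val e)) == ij]| = edge_matrix D ij.1 ij.2.
    rewrite edge_matrixE enum_fsetE count_map cardsE cardE -size_filter enumT /=.
    by congr size; apply: eq_filter.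
  over.
(* Pairs with [i >= j] contribute the factor [0! = 1], so the product may be restricted to
   [i < j]. *)
rewrite -(pair_bigA _ (fun i j => (edge_matrix D i j)`!)) /=.
apply: eq_bigr => i _; rewrite [RHS]big_mkcond; apply: eq_bigr => j _.
by case: ifP => // nij; rewrite mxE nij.
Qed.

Lemma card_web_world_of :
  #|` web_world_of D| * \prod_(i < n) \prod_(j < n | i < j) (edge_matrix D i j)`! =
  \prod_(i < n) (row_col_sum (edge_matrix D) i)`!.
Proof.
rewrite -card_peg_preserving -(card_fibers card_permute_heights_fiber).
rewrite card_dep_ffun foldrE big_map big_enum /=.
by apply: eq_bigr => i _; rewrite card_Sn row_col_sum_edge_matrix.
Qed.

End WebWorld.

Theorem theorem4p7 (n : nat) (W : {fset {fset edge n}}) (D : {fset edge n}) :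
  web_world W -> D \in W ->
  let A := edge_matrix D in
  (#|` W|%:R =
     (\prod_(i < n) (row_col_sum A i)`!)%N%:R /
     (\prod_(i < n) \prod_(j < n | (i < j)%N) (A i j)`!)%N%:R :> rat)%R.
Proof.
move=> [D0 webD0 ->] /imfsetP[s _ ->] /=.
(* The matrix of [D] is that of the generating diagram [D0], and the division is legitimate because
   factorials are positive. *)
rewrite edge_matrix_permute_heights // -card_web_world_of // GRing.natrM GRing.mulfK //.
rewrite Num.Theory.pnatr_eq0 -lt0n; apply: prodn_gt0 => i.
by apply: prodn_cond_gt0 => j _; apply: fact_gt0.
Qed.
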